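(* Let $\gamma\in(0,1)$, $K\in\mathbb N$ and accuracy levels $\ell_1,\dots,\ell_K\in\mathbb N$ be given. Consider the sequence of failure sets $F_j^{\mathrm{ML}}$, $j=1,\dots,K$, where either (A) the uniform error assumption (stated in the context) is satisfied and $F_j^{\mathrm{ML}}=\{\omega:G_{\ell_j}(\omega)\le y_j\}$, or (B) the selective refinement assumption (stated in the context) is satisfied and $F_j^{\mathrm{ML}}=\{\omega:G_{\ell_j}^{y_j}(\omega)\le y_j\}$. Let $y_K=0$ and $y_0=\infty$, and choose $$y_j=y_{j+1}+(\gamma^{\ell_j}+\gamma^{\ell_{j+1}})>0,\qquad j=K-1,\dots,1.$$ Then the subset property $F_{j+1}^{\mathrm{ML}}\subset F_j^{\mathrm{ML}}$ holds for $j=1,\dots,K-1$.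
   Context: $(\Omega,\Sigma,\mathbb P)$ is a probability space and $G:\Omega\to\mathbb R$ is a random variable having a probability density with respect to Lebesgue measure. $\mathcal C[\cdot]$ denotes the computational cost of evaluating a random variable. Fix $\gamma\in(0,1)$, $q\ge0$. The accuracy levels satisfy $\ell_j\le L$ for a maximum level $L$; typically $\ell_j\ge\ell_{j-1}$ and $\ell_K=L$. Uniform error assumption: (a) there is $c_{\mathrm{Lip}}>0$ with $|\mathbb P(G\le y)-\mathbb P(G\le x)|\le c_{\mathrm{Lip}}|y-x|$ for all $x,y\in\mathbb R$; (b) for all $\ell\in\mathbb N$ there is a random variable $G_\ell$ with $|G(\omega)-G_\ell(\omega)|\le\gamma^\ell$ $\mathbb P$-a.s. in $\omega$, and there is a constant $c_0>0$ with $\mathbb E[\mathcal C[G_\ell]]\le c_0\gamma^{-\ell q}$. Selective refinement assumption (used at $y=y_1,\dots,y_K$): part (a) above holds and, for fixed $y\in\mathbb R$ and all $\ell\in\mathbb N$, there is a random variable $G_\ell^y$ (possibly depending on $y$) with $|G(\omega)-G_\ell^y(\omega)|\le\max(\gamma^\ell,|G_\ell^y(\omega)-y|)$ $\mathbb P$-a.s. in $\omega$, and there is a constant $c_0>0$ with $\mathbb E[\mathcal C[G_\ell^y]]\le c_0(1+\gamma^{(1-q)\ell})$.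
   Formalization: The subset property is stated up to a null set (the difference of F_{j+1} and F_j is negligible), since the error bounds hold only almost surely and pointwise inclusion can fail after changing an approximation on a null set. *)

(* Defs.v *)
From HB Require Import structures.
From mathcomp Require Import all_boot all_order all_algebra.
From mathcomp Require Import all_classical all_reals all_analysis.

Set Implicit Arguments.
Unset Strict Implicit.
Unset Printing Implicit Defensive.

Import Order.TTheory GRing.Theory Num.Theory.
Import numFieldNormedType.Exports.

Local Open Scope classical_set_scope.
Local Open Scope ring_scope.

Definition has_density (d : measure_display) (Omega : measurableType d)
    (R : realType) (P : probability Omega R) (G : {RV P >-> R}) : Prop :=
  exists f : R -> R,
    [/\ measurable_fun setT f, (forall x, 0 <= f x) &
        forall A : set R, measurable A ->
          distribution P G A = (\int[lebesgue_measure]_(x in A) (f x)%:E)%E].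

Definition lipschitz_cdf (d : measure_display) (Omega : measurableType d)
    (R : realType) (P : probability Omega R) (G : {RV P >-> R}) : Prop :=
  exists2 c : R, 0 < c &
    forall x y : R,
      (`| P [set w | (G w <= y)%R] - P [set w | (G w <= x)%R] |
         <= (c * `|y - x|)%:E)%E.

(* [C X] is the random cost [w |-> C[X](w)] of evaluating [X].  The constant
   [c0] does not depend on the level [l]. *)
Definition uniform_error (d : measure_display) (Omega : measurableType d)
    (R : realType) (P : probability Omega R)
    (C : {RV P >-> R} -> {RV P >-> R}) (gamma q : R)
    (G : {RV P >-> R}) (Gl : nat -> {RV P >-> R}) : Prop :=
  [/\ lipschitz_cdf G,
      (forall l : nat, {ae P, forall w, `|G w - Gl l w| <= gamma ^+ l}) &
      exists2 c0 : R, 0 < c0 &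
        forall l : nat, ('E_P[C (Gl l)] <= (c0 * gamma `^ (- (l%:R * q)))%:E)%E].

(* The threshold [y] is fixed; [Gl l] is the approximation G_l^y, and [c0] may
   depend on [y] but not on [l]. *)
Definition selective_refinement (d : measure_display)
    (Omega : measurableType d) (R : realType) (P : probability Omega R)
    (C : {RV P >-> R} -> {RV P >-> R}) (gamma q : R)
    (G : {RV P >-> R}) (y : R) (Gl : nat -> {RV P >-> R}) : Prop :=
  [/\ lipschitz_cdf G,
      (forall l : nat,
         {ae P, forall w,
            `|G w - Gl l w| <= Num.max (gamma ^+ l) `|Gl l w - y|}) &
      exists2 c0 : R, 0 < c0 &
        forall l : nat,
          ('E_P[C (Gl l)] <= (c0 * (1 + gamma `^ ((1 - q) * l%:R)))%:E)%E].

(* Events defined through bounds that hold only almost surely can be compared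
   only up to a null set: modifying an approximation on a null set preserves
   the error bounds but may destroy a pointwise inclusion of failure sets. *)
Definition subset_as (d : measure_display) (Omega : measurableType d)
    (R : realType) (P : probability Omega R) (A B : set Omega) : Prop :=
  P.-negligible (A `\` B).

(* Main.v *)
(* Both error assumptions confine G once the position of an approximation
   relative to its threshold y is known: with tolerance e, an approximation
   that is at most y forces G <= y + e, and one that exceeds y forces
   G > y - e.  The spacing of the levels is such that
   y_{j+1} + gamma^l_{j+1} = y_j - gamma^l_j, so almost surely no point of
   F_{j+1} can lie outside F_j. *)
Require Import Defs.
From HB Require Import structures.
From mathcomp Require Import all_boot all_order all_algebra.
From mathcomp Require Import all_classical all_reals all_analysis.
From mathcomp Require Import lra.

Set Implicit Arguments.
Unset Strict Implicit.
Unset Printing Implicit Defensive.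

Import Order.TTheory GRing.Theory Num.Theory.
Import numFieldNormedType.Exports.

Local Open Scope classical_set_scope.
Local Open Scope ring_scope.

(** If the maximum is [e], then [g <= a + e <= y + e]. Otherwise the error is at most [y - a], so
    [g] cannot pass [y] at all. *)
Lemma refined_le (R : realType) (g a e y : R) :
  0 <= e -> `|g - a| <= Num.max e `|a - y| -> a <= y -> g <= y + e.
Proof.
move=> e0 h ay; have ga := ler_norm (g - a).
move: h; rewrite (ler0_norm (x := a - y)) ?subr_le0// le_max => /orP[] h; lra.
Qed.

(** If the error is at most [e], then [g >= b - e > y - e]. If it is at most [b - y], only [g >= y]
    follows, and strictness comes from [0 < e]. *)
Lemma refined_gt (R : realType) (g b e y : R) :
  0 < e -> `|g - b| <= Num.max e `|b - y| -> y < b -> y - e < g.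
Proof.
move=> e0 h yb; have gb := ler_norm (b - g).
move: h; rewrite distrC (gtr0_norm (x := b - y)) ?subr_gt0// le_max => /orP[] h; lra.
Qed.

Lemma subset_as_refined (d : measure_display) (Omega : measurableType d)
    (R : realType) (P : probability Omega R) (G X Y : Omega -> R)
    (a b x y : R) :
  0 < a -> 0 < b -> y = x + (b + a) ->
  {ae P, forall w, `|G w - X w| <= Num.max a `|X w - x|} ->
  {ae P, forall w, `|G w - Y w| <= Num.max b `|Y w - y|} ->
  subset_as P [set w | X w <= x] [set w | Y w <= y].
Proof.
move=> a0 b0 yE GX GY; apply: negligibleS (negligibleU GX GY) => w /= [Xx].
move=> /negP; rewrite -ltNge => Yy.
(* Off the two exceptional null sets both bounds hold at [w], giving
   [G w <= x + a = y - b < G w]. *)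
apply/not_andP => -[hX hY].
have Gle := refined_le (ltW a0) hX Xx.
have Ggt := refined_gt b0 hY Yy.
by lra.
Qed.

(** Thresholds live in the extended reals only for the sake of [y 0 = +oo]; from index 1 on, the
    recursion down from [y K = 0] keeps them real. *)
Lemma threshold_fin (R : realType) (K : nat) (y : nat -> \bar R)
    (e : nat -> R) :
  (forall j, 0 <= e j) -> y K = 0%E ->
  (forall j, (1 <= j < K)%N -> y j = (y j.+1 + (e j)%:E)%E) ->
  forall j, (1 <= j <= K)%N -> exists2 r : R, 0 <= r & y j = r%:E.
Proof.
move=> e0 yK yS j /andP[j1 jK].
(* Downward induction on [j], run on the distance [i] to [K]. *)
have [i iE] : exists i, i = (K - j)%N by exists (K - j)%N.
elim: i j j1 jK iE => [|i IH] j j1 jK iE.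
  exists 0 => //; rewrite -[RHS]yK; congr y.
  by apply/eqP; rewrite eqn_leq jK -subn_eq0 -iE.
have jltK : (j < K)%N by rewrite -subn_gt0 -iE.
have [//|//||r r0 yr] := IH j.+1; first by rewrite subnS -iE.
exists (r + e j); first by rewrite addr_ge0.
by rewrite yS ?j1// yr EFinD.
Qed.

Theorem lemma3p2 (d : measure_display) (Omega : measurableType d)
    (R : realType) (P : probability Omega R)
    (C : {RV P >-> R} -> {RV P >-> R}) (hC : forall X w, 0 <= C X w)
    (G : {RV P >-> R}) (hG : has_density G)
    (gamma q : R) (hgamma0 : 0 < gamma) (hgamma1 : gamma < 1) (hq : 0 <= q)
    (K : nat) (hK : (0 < K)%N)
    (L : nat) (ell : nat -> nat)
    (hL : forall j : nat, (1 <= j <= K)%N -> (ell j <= L)%N)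
    (y : nat -> \bar R) (hyK : y K = 0%E) (hy0 : y 0%N = +oo%E)
    (hy : forall j : nat, (1 <= j < K)%N ->
       y j = (y j.+1 + (gamma ^+ ell j + gamma ^+ ell j.+1)%:E)%E)
    (F : nat -> set Omega)
    (hF :
       (exists Gl : nat -> {RV P >-> R},
          uniform_error C gamma q G Gl /\
          forall j : nat, (1 <= j <= K)%N ->
            F j = [set w | ((Gl (ell j) w)%:E <= y j)%E])
       \/
       (exists Gs : R -> nat -> {RV P >-> R},
          (forall j : nat, (1 <= j <= K)%N ->
             selective_refinement C gamma q G (fine (y j)) (Gs (fine (y j)))) /\
          forall j : nat, (1 <= j <= K)%N ->
            F j = [set w | ((Gs (fine (y j)) (ell j) w)%:E <= y j)%E])) :
  forall j : nat, (1 <= j < K)%N ->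
    (0 < y j)%E /\ subset_as P (F j.+1) (F j).
Proof.
have e0 l : 0 < gamma ^+ l by rewrite exprn_gt0.
have yfin := threshold_fin (fun j => ltW (addr_gt0 (e0 (ell j)) (e0 (ell j.+1)))) hyK hy.
move=> j jK; have /andP[j1 jltK] := jK.
have j1K : (1 <= j <= K)%N by rewrite j1 ltnW.
have jSK : (1 <= j.+1 <= K)%N by [].
have [r r0 yr] := yfin _ jSK.
have ej := e0 (ell j); have eS := e0 (ell j.+1).
have yjE : y j = (r + (gamma ^+ ell j + gamma ^+ ell j.+1))%:E.
  by rewrite hy// yr EFinD.
split; first by rewrite yjE lte_fin; lra.
case: hF => [[Gl [[_ err _] FE]]|[Gs [err FE]]]; rewrite !FE// yjE yr.
  (* A uniform bound implies the refined one for every threshold [t], so case (A) reduces to the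
     argument for case (B). *)
  have err' l t : {ae P, forall w,
      `|G w - Gl l w| <= Num.max (gamma ^+ l) `|Gl l w - t|}.
    by apply: negligibleS (err l) => w /=; apply: contra_not => h; rewrite le_max h.
  exact: subset_as_refined eS ej erefl (err' _ _) (err' _ _).
(* The two approximations are refined around different thresholds, so the assumption is used at both
   [y j] and [y j.+1]. *)
have [_ errj _] := err _ j1K; have [_ errS _] := err _ jSK.
rewrite yjE /= in errj *; rewrite yr /= in errS *.
exact: subset_as_refined eS ej erefl (errS _) (errj _).
Qed.
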